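(* Let $\mathcal{S}$ and $\mathcal{T}$ be b0-spaces. A map $f\colon|\mathcal{S}|\to|\mathcal{T}|$ is basic continuous (as a map $\mathcal{S}\to\mathcal{T}$) if and only if it satisfies the following properties: (BC1') $f^{-1}[\mathsf{O}]=\mathsf{O}$. (BC2') There exists a map $f_{\leftarrow}\colon\mathcal{B}d(\mathcal{T})\to\mathcal{B}d(\mathcal{S})$ such that, for every $M\in\mathcal{B}d(\mathcal{S})$ and $K\in\mathcal{B}d(\mathcal{T})$, $f[M]\subseteq K$ if and only if $M\subseteq f_{\leftarrow}[K]$. (BC3') For every $C\in\mathcal{C}(\mathcal{T})$, $f_{\leftarrow}[C]\in\mathcal{C}(\mathcal{S})$. (BC4') For every $C\in\mathcal{C}(\mathcal{T})$, $f_{\leftarrow}[\neg C]=\neg f_{\leftarrow}[C]$. Moreover, the map $f_{\leftarrow}$ in (BC2') is precisely the basic preimage of $f$.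
   Context: A closure system on a set $X$ is a family of subsets of $X$ containing $X$ and closed under arbitrary intersections; ordered by inclusion it is a complete lattice whose meets are intersections and whose joins $\vee$ are the least members containing the union. A basic zero-dimensional space (b0-space) is a triple $\mathcal{S}=(X,\mathcal{C},\mathcal{B}d)$ where $X$ is a set, $\mathcal{B}d$ is a closure system on $X$ that is distributive as a lattice, and $\mathcal{C}\subseteq\mathcal{B}d$ is such that every $C\in\mathcal{C}$ has a complement $\neg C$ in the lattice $\mathcal{B}d$, and every $M\in\mathcal{B}d$ is of the form $M=\bigcap_{i\in J}(C_i^1\vee\neg D_i^1\vee\dots\vee C_i^{n_i}\vee\neg D_i^{n_i})$ with all $C_i^k,D_i^k\in\mathcal{C}$ (finite joins in $\mathcal{B}d$, the empty join being allowed). Write $|\mathcal{S}|=X$, $\mathcal{C}(\mathcal{S})=\mathcal{C}$, $\mathcal{B}d(\mathcal{S})=\mathcal{B}d$; the bottom element of $\mathcal{B}d$ is denoted $\mathsf{O}$ (same symbol for every b0-space). A basic continuous map $f\colon\mathcal{S}\to\mathcal{T}$ between b0-spaces is a map $f\colon|\mathcal{S}|\to|\mathcal{T}|$ such that: (BC1) $f^{-1}[\mathsf{O}]=\mathsf{O}$; (BC2) there is a map $f_{\leftarrow}^{\mathfrak{c}}\colon\mathcal{C}(\mathcal{T})\to\mathcal{C}(\mathcal{S})$ such that $f[B]\subseteq C$ iff $B\subseteq f_{\leftarrow}^{\mathfrak{c}}[C]$ for all $B\in\mathcal{C}(\mathcal{S})$, $C\in\mathcal{C}(\mathcal{T})$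 (this map is then unique); (BC3) $\neg f_{\leftarrow}^{\mathfrak{c}}[C]\subseteq f^{-1}[\neg C]$ for all $C\in\mathcal{C}(\mathcal{T})$; (BC4) $\bigvee_{i=1}^n(f_{\leftarrow}^{\mathfrak{c}}[C_i]\vee\neg f_{\leftarrow}^{\mathfrak{c}}[D_i])\subseteq f^{-1}[\bigvee_{i=1}^n(C_i\vee\neg D_i)]$ for all $n$ and all $C_i,D_i\in\mathcal{C}(\mathcal{T})$. For a basic continuous $f$, the basic image is $f_{\rightarrow}\colon\mathcal{B}d(\mathcal{S})\to\mathcal{B}d(\mathcal{T})$, $f_{\rightarrow}[M]=\bigcap\{S\in\mathcal{B}d(\mathcal{T})\mid f[M]\subseteq S\}$; it has a right adjoint, which is called the basic preimage of $f$. *)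

(* Defs.v *)
From mathcomp Require Import all_boot.
From mathcomp Require Import boolp classical_sets functions.

Set Implicit Arguments.
Unset Strict Implicit.
Unset Printing Implicit Defensive.

Local Open Scope classical_set_scope.

Definition closure_system (X : Type) (Bd : set (set X)) : Prop :=
  Bd setT /\
  forall G : set (set X), G `<=` Bd -> Bd (\bigcap_(M in G) M).

Section ClosureSystemLattice.
Variables (X : Type) (Bd : set (set X)).

(* [smallest Bd U] is the intersection of all members of [Bd] containing [U],
   which is the least such member when [Bd] is a closure system. *)
Definition join (A B : set X) : set X := smallest Bd (A `|` B).

Definition bigjoin (I : Type) (F : I -> set X) : set X :=
  smallest Bd (\bigcup_i F i).

Definition bottom : set X := smallest Bd set0.

Definition distributive_system : Prop :=
  forall A B C : set X, Bd A -> Bd B -> Bd C ->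
    A `&` join B C = join (A `&` B) (A `&` C).

Definition is_complement (A B : set X) : Prop :=
  [/\ Bd B, A `&` B = bottom & join A B = setT].

(* The default value [set0] is only returned when [A] has no complement. *)
Definition neg (A : set X) : set X := xget set0 [set B | is_complement A B].

(* The join for [n = 0] is [bottom]. *)
Definition clause (n : nat) (C D : 'I_n -> set X) : set X :=
  bigjoin (fun k => join (C k) (neg (D k))).

End ClosureSystemLattice.

Record b0space := B0Space {
  points :> Type;
  basics : set (set points);
  Bd : set (set points);
  Bd_closure_system : closure_system Bd;
  Bd_distributive : distributive_system Bd;
  basics_sub_Bd : basics `<=` Bd;
  basics_complemented :
    forall C, basics C -> exists D, is_complement Bd C D;
  Bd_generated :
    forall M, Bd M -> exists2 G : set (set points),
      (forall A, G A -> exists (n : nat) (C D : 'I_n -> set points),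
         (forall k, basics (C k) /\ basics (D k)) /\ A = clause Bd C D) &
      M = \bigcap_(A in G) A
}.

Arguments basics : clear implicits.
Arguments Bd : clear implicits.

Definition O (S : b0space) : set S := bottom (Bd S).

Arguments O : clear implicits.

Section BasicContinuity.
Variables (S T : b0space) (f : S -> T).

(* Maps between families of sets are represented by total functions on all
   subsets, of which only the values on the domain family are relevant;
   [set_fun A B g] says that [g] maps the family [A] into the family [B]. *)

Definition BC1 : Prop := f @^-1` O T = O S.

Definition BC2 (fc : set T -> set S) : Prop :=
  set_fun (basics T) (basics S) fc /\
  forall B C, basics S B -> basics T C -> (f @` B `<=` C <-> B `<=` fc C).

Definition BC3 (fc : set T -> set S) : Prop :=
  forall C, basics T C -> neg (Bd S) (fc C) `<=` f @^-1` neg (Bd T) C.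

Definition BC4 (fc : set T -> set S) : Prop :=
  forall (n : nat) (C D : 'I_n -> set T),
    (forall k, basics T (C k) /\ basics T (D k)) ->
    clause (Bd S) (fun k => fc (C k)) (fun k => fc (D k))
      `<=` f @^-1` clause (Bd T) C D.

Definition basic_continuous : Prop :=
  BC1 /\ exists fc : set T -> set S, [/\ BC2 fc, BC3 fc & BC4 fc].

Definition basic_image (M : set S) : set T := smallest (Bd T) (f @` M).

(* right adjoint of [basic_image], as a map from [Bd T] to [Bd S] *)
Definition is_basic_preimage (g : set T -> set S) : Prop :=
  set_fun (Bd T) (Bd S) g /\
  forall M K, Bd S M -> Bd T K -> (basic_image M `<=` K <-> M `<=` g K).

Definition BC2' (g : set T -> set S) : Prop :=
  set_fun (Bd T) (Bd S) g /\
  forall M K, Bd S M -> Bd T K -> (f @` M `<=` K <-> M `<=` g K).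

Definition BC3' (g : set T -> set S) : Prop :=
  forall C, basics T C -> basics S (g C).

Definition BC4' (g : set T -> set S) : Prop :=
  forall C, basics T C -> g (neg (Bd T) C) = neg (Bd S) (g C).

End BasicContinuity.

(* Main.v *)
Require Import Defs.
From mathcomp Require Import all_boot.
From mathcomp Require Import boolp classical_sets functions.

Local Open Scope classical_set_scope.

(** Everything reduces to one principle.  Let [A], [A'] be complements in [Bd S]
    and [K], [K'] complements in [Bd T], and suppose that [f] maps [A'] into [K'].
    A member [M] of [Bd S] that [f] maps into [K] then satisfies
    [M `&` A' `<=` f @^-1` (K `&` K') = f @^-1` O T = O S], so distributivity gives
    [M `<=` A] (lemma [sub_of_complement_preimage]).  If [f] also maps [A] into
    [K], then [A] is the largest member of [Bd S] inside [f @^-1` K], that is, the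
    value at [K] of any right adjoint [g] as in [BC2'].

    Suppose [f] is basic continuous, with witness [fc].  For [C] basic, [f] maps
    [fc C] into [C] by [BC2] and [neg (fc C)] into [neg C] by [BC3]; the principle,
    used for these pairs in both orders, yields [g C = fc C] and
    [g (neg C) = neg (fc C)].  It remains to construct [g].  By the De Morgan law
    ([complement_clause]), the complement of the finite join of the
    [join (C k) (neg (D k))] is the intersection of the [neg (C k) `&` D k], and [f] maps
    the intersection of the [neg (fc (C k)) `&` fc (D k)] into it, again by [BC2]
    and [BC3].  Hence a member of [Bd S] that [f] maps into a clause of [T] lies in
    the clause of [S] obtained by applying [fc]; [BC4] is the converse.  Every
    member [K] of [Bd T] is an intersection of clauses, so
    intersecting the transported clauses, over all clauses above [K], gives [g K].

    Conversely, a [g] as in [BC2'], [BC3'], [BC4'] can itself serve as [fc]: being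
    monotone, it maps each literal of a clause [K] below [g K], which gives [BC4].

    Finally, for [K] in [Bd T] the conditions [f @` M `<=` K] and
    [basic_image f M `<=` K] agree, so [BC2'] says precisely that [g] is right
    adjoint to [basic_image f], and right adjoints are unique. *)

(** * Complements in a distributive closure system *)

Section ClosureSystem.
Set Implicit Arguments.
Unset Strict Implicit.
Variables (X : Type) (Bd : set (set X)).
Hypothesis Bd_closed : closure_system Bd.

Lemma closure_system_smallest U : Bd (smallest Bd U).
Proof. by apply: Bd_closed.2 => A []. Qed.

Lemma closure_system_bigcap I (P : set I) (F : I -> set X) :
  (forall i, P i -> Bd (F i)) -> Bd (\bigcap_(i in P) F i).
Proof.
move=> BdF; have := @bigcap_image _ _ _ P F id; rewrite /= => <-.
by apply: Bd_closed.2 => _ [i Pi <-]; exact: BdF.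
Qed.

Lemma closure_systemI A B : Bd A -> Bd B -> Bd (A `&` B).
Proof.
move=> BdA BdB; rewrite -bigcap2E; apply: closure_system_bigcap => -[|[|i]] _ //=.
exact: Bd_closed.1.
Qed.

Lemma bottom_sub A : Bd A -> bottom Bd `<=` A.
Proof. by move=> BdA; apply: smallest_sub. Qed.

Lemma join_sub A B N : Bd N -> A `<=` N -> B `<=` N -> join Bd A B `<=` N.
Proof. by move=> BdN AN BN; apply: smallest_sub => //; rewrite subUset. Qed.

Lemma join_ubl A B : A `<=` join Bd A B.
Proof. by apply: sub_smallest; exact: subsetUl. Qed.

Lemma join_ubr A B : B `<=` join Bd A B.
Proof. by apply: sub_smallest; exact: subsetUr. Qed.

Lemma bigjoin_ub I (F : I -> set X) i : F i `<=` bigjoin Bd F.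
Proof. by apply: sub_smallest; exact: bigcup_sup. Qed.

Lemma bigjoin_sub I (F : I -> set X) N :
  Bd N -> (forall i, F i `<=` N) -> bigjoin Bd F `<=` N.
Proof. by move=> BdN FN; apply: smallest_sub => // x [i _]; exact: FN. Qed.

Lemma bigjoin_ord0 (F : 'I_0 -> set X) : bigjoin Bd F = bottom Bd.
Proof. by rewrite /bigjoin bigcup0 // => -[]. Qed.

Lemma bigjoin_ord_recl n (F : 'I_n.+1 -> set X) :
  bigjoin Bd F = join Bd (F ord0) (bigjoin Bd (fun k => F (lift ord0 k))).
Proof.
apply/seteqP; split.
  apply: bigjoin_sub => [|k]; first exact: closure_system_smallest.
  case: (unliftP ord0 k) => [j|] ->; last exact: join_ubl.
  by apply: subset_trans (@join_ubr _ _); exact: bigjoin_ub.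
apply: join_sub; first exact: closure_system_smallest.
  exact: bigjoin_ub.
apply: bigjoin_sub => [|k]; first exact: closure_system_smallest.
exact: (@bigjoin_ub _ F).
Qed.

Lemma bigcap_ord_recl n (F : 'I_n.+1 -> set X) :
  \bigcap_k F k = F ord0 `&` \bigcap_k F (lift ord0 k).
Proof.
apply/seteqP; split=> [x Fx|x [F0x Fx] k _]; first by split=> [|k _]; exact: Fx.
by case: (unliftP ord0 k) => [j|] -> //; exact: Fx.
Qed.

Hypothesis Bd_distr : distributive_system Bd.

(** Case distinction on [A], valid in any distributive lattice because
    [M] is the join of [M `&` A] and [M `&` A']; it stands in for the excluded
    middle, since [A'] need not be the set-theoretic complement. *)
Lemma complement_cases A A' M N : is_complement Bd A A' ->
  Bd A -> Bd M -> Bd N -> M `&` A `<=` N -> M `&` A' `<=` N -> M `<=` N.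
Proof.
case=> BdA' _ AA' BdA BdM BdN MAN MA'N.
by rewrite -[M]setIT -AA' Bd_distr //; exact: join_sub.
Qed.

Lemma is_complementC A A' : is_complement Bd A A' -> Bd A -> is_complement Bd A' A.
Proof. by case=> BdA' AIA' AUA' BdA; split=> //; rewrite 1?setIC // /join setUC. Qed.

Lemma complement_bottom : is_complement Bd (bottom Bd) setT.
Proof.
split; [exact: Bd_closed.1 | by rewrite setIT |].
by apply/seteqP; split=> // ; exact: join_ubr.
Qed.

(** De Morgan: disjointness is distributivity, and that the two sides jointly
    cover [X] follows by deciding first [A] and then [B]. *)
Lemma complement_join A A' B B' : Bd A -> Bd B ->
  is_complement Bd A A' -> is_complement Bd B B' ->
  is_complement Bd (join Bd A B) (A' `&` B').
Proof.
move=> BdA BdB cA cB; have [BdA' AIA' _] := cA; have [BdB' BIB' _] := cB.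
have BdI : Bd (A' `&` B') by exact: closure_systemI.
split=> //; apply/seteqP; split=> //.
- rewrite setIC Bd_distr //; apply: join_sub.
  + exact: closure_system_smallest.
  + by rewrite -AIA' => x [[]].
  + by rewrite -BIB' => x [[]].
- by apply: bottom_sub; apply: closure_systemI => //; exact: closure_system_smallest.
have BdN : Bd (join Bd (join Bd A B) (A' `&` B')).
  exact: closure_system_smallest.
apply: (complement_cases cA) => //; first exact: Bd_closed.1.
  by move=> x [_ Ax]; apply: join_ubl; exact: join_ubl.
rewrite setTI; apply: (complement_cases cB) => //.
  by move=> x [_ Bx]; apply: join_ubl; exact: join_ubr.
exact: join_ubr.
Qed.

Lemma complement_bigjoin n (F F' : 'I_n -> set X) :
  (forall k, Bd (F k)) -> (forall k, is_complement Bd (F k) (F' k)) ->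
  is_complement Bd (bigjoin Bd F) (\bigcap_k F' k).
Proof.
elim: n F F' => [|n IHn] F F' BdF cF.
  rewrite bigjoin_ord0 (_ : bigcap _ _ = setT); first exact: complement_bottom.
  by apply/seteqP; split=> // x _ [].
rewrite bigjoin_ord_recl bigcap_ord_recl; apply: complement_join => //.
- exact: closure_system_smallest.
- exact: IHn.
Qed.

Lemma neg_complement A : (exists A', is_complement Bd A A') -> is_complement Bd A (neg Bd A).
Proof. exact: (@xgetPex _ set0 [set A' | is_complement Bd A A']). Qed.

Lemma complement_clause n (C D : 'I_n -> set X) :
  (forall k, Bd (C k) /\ is_complement Bd (C k) (neg Bd (C k))) ->
  (forall k, Bd (D k) /\ is_complement Bd (D k) (neg Bd (D k))) ->
  is_complement Bd (clause Bd C D) (\bigcap_k (neg Bd (C k) `&` D k)).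
Proof.
move=> cC cD; apply: complement_bigjoin => k; first exact: closure_system_smallest.
have [BdC cCk] := cC k; have [BdD cDk] := cD k.
by apply: complement_join => //; [case: cDk | exact: is_complementC].
Qed.

End ClosureSystem.

(** * Basic sets and clauses *)

Section B0Space.
Set Implicit Arguments.
Unset Strict Implicit.
Variable S : b0space.

Lemma basics_neg C :
  basics S C -> Bd S C /\ is_complement (Bd S) C (neg (Bd S) C).
Proof.
by move=> SC; split; [exact: basics_sub_Bd | exact/neg_complement/basics_complemented].
Qed.

Lemma Bd_clause n (C D : 'I_n -> set S) : Bd S (clause (Bd S) C D).
Proof. by apply: closure_system_smallest; exact: Bd_closure_system. Qed.

End B0Space.

(** * Comparing preimages with complements *)

Section BasicContinuity.
Set Implicit Arguments.
Unset Strict Implicit.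
Variables (S T : b0space) (f : S -> T).

(** The only use of [BC1]: the part of [M] inside [A'] is mapped into both [C]
    and [C'], hence into the bottom element, so it is itself in the bottom. *)
Lemma sub_of_complement_preimage A A' C C' M : BC1 f ->
  is_complement (Bd S) A A' -> is_complement (Bd T) C C' ->
  Bd S A -> Bd S M ->
  A' `<=` f @^-1` C' -> M `<=` f @^-1` C -> M `<=` A.
Proof.
move=> f1 cA [_ CC' _] BdA BdM A'C' MC.
apply: (complement_cases (@Bd_distributive S) cA) => //.
apply: subset_trans (@bottom_sub _ (Bd S) _ BdA).
rewrite -[bottom _]f1 /O -CC' => x [Mx A'x].
by split; [exact: MC | exact: A'C'].
Qed.

Lemma BC2'_preimage g K : BC2' f g -> Bd T K -> g K `<=` f @^-1` K.
Proof.
by move=> [gBd adj] BdK; rewrite -image_sub; apply/(adj _ _ (gBd _ BdK) BdK).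
Qed.

Lemma BC2'_max g K M : BC2' f g -> Bd T K -> Bd S M -> M `<=` f @^-1` K ->
  M `<=` g K.
Proof. by move=> [_ adj] BdK BdM MK; apply/adj => //; rewrite image_sub. Qed.

(** The criterion for computing an adjoint at a complemented element: no
    maximality has to be checked, only that [f] respects the two pairs. *)
Lemma BC2'_eq_of_complements g K A A' K' : BC1 f -> BC2' f g ->
  is_complement (Bd S) A A' -> is_complement (Bd T) K K' ->
  Bd S A -> Bd T K -> A `<=` f @^-1` K -> A' `<=` f @^-1` K' -> g K = A.
Proof.
move=> f1 g2 cA cK BdA BdK AK A'K'; apply/seteqP; split; last exact: BC2'_max.
apply: (sub_of_complement_preimage f1 cA cK) => //; last exact: BC2'_preimage.
exact: g2.1.
Qed.

(** Members of [Bd T] cannot distinguish [f @` M] from its closure. *)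
Lemma is_basic_preimageE g : is_basic_preimage f g <-> BC2' f g.
Proof.
have imE M K : Bd T K -> (basic_image f M `<=` K <-> f @` M `<=` K).
  move=> BdK; split; first exact: subset_trans (@sub_gen_smallest _ _ _).
  exact: smallest_sub.
split=> -[gBd adj]; split=> // M K BdM BdK.
  by rewrite -imE //; exact: adj.
by rewrite imE //; exact: adj.
Qed.

Lemma BC2'_unique g h K : BC2' f g -> BC2' f h -> Bd T K -> g K = h K.
Proof.
move=> g2 h2 BdK; apply/seteqP; split; apply: BC2'_max => //.
- exact: g2.1.
- exact: BC2'_preimage.
- exact: h2.1.
- exact: BC2'_preimage.
Qed.

(** * From basic preimages to the full adjoint *)

(** Taking every clause above [K], rather than one chosen representation of [K],
    makes the value independent of choices. *)
Definition preimage_of_basics (fc : set T -> set S) (K : set T) : set S :=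
  \bigcap_(A in [set A | exists n (C D : 'I_n -> set T),
      [/\ forall k, basics T (C k) /\ basics T (D k), K `<=` clause (Bd T) C D &
          A = clause (Bd S) (fun k => fc (C k)) (fun k => fc (D k))]]) A.

Section FromBasics.
Variable fc : set T -> set S.
Hypotheses (f1 : BC1 f) (f2 : BC2 f fc) (f3 : BC3 f fc).

Lemma BC2_preimage C : basics T C -> fc C `<=` f @^-1` C.
Proof.
by move=> TC; rewrite -image_sub; apply/(f2.2 _ _ (f2.1 _ TC) TC).
Qed.

(** The converse of [BC4], which [BC1]-[BC3] already imply: [f] maps the De Morgan
    complement of the transported clause into that of the original one. *)
Lemma sub_clause_of_preimage n (C D : 'I_n -> set T) M :
  (forall k, basics T (C k) /\ basics T (D k)) -> Bd S M ->
  M `<=` f @^-1` clause (Bd T) C D ->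
  M `<=` clause (Bd S) (fun k => fc (C k)) (fun k => fc (D k)).
Proof.
move=> TCD BdM.
apply: (@sub_of_complement_preimage _ (\bigcap_k (neg (Bd S) (fc (C k)) `&` fc (D k)))
  _ (\bigcap_k (neg (Bd T) (C k) `&` D k))) => //.
- apply: (complement_clause (Bd_closure_system S) (@Bd_distributive S)) => k.
    by apply: basics_neg; apply: f2.1; case: (TCD k).
  by apply: basics_neg; apply: f2.1; case: (TCD k).
- apply: (complement_clause (Bd_closure_system T) (@Bd_distributive T)) => k.
    by apply: basics_neg; case: (TCD k).
  by apply: basics_neg; case: (TCD k).
- exact: Bd_clause.
- move=> x SCDx k _; have [TC TD] := TCD k; have [nCx Dx] := SCDx k I.
  by split; [exact: f3 TC _ nCx | exact: (BC2_preimage TD) Dx].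
Qed.

Lemma preimage_of_basics_adjoint : BC4 f fc -> BC2' f (preimage_of_basics fc).
Proof.
move=> f4; split=> [K BdK|M K BdM BdK].
  apply: (closure_system_bigcap (Bd_closure_system S)) => _ [n [C [D [_ _ ->]]]].
  exact: Bd_clause.
rewrite image_sub; split=> [MK x Mx _ [n [C [D [TCD KCD ->]]]]|MgK].
  by apply: sub_clause_of_preimage Mx => // y /MK; exact: KCD.
(* Each clause in a representation of [K] is among those indexing
   [preimage_of_basics], so [BC4] applies to it. *)
apply: subset_trans MgK _; have [G GP KE] := Bd_generated BdK.
rewrite [X in f @^-1` X]KE => x gKx A GA; have [n [C [D [TCD AE]]]] := GP A GA.
rewrite AE; apply: (f4 _ _ _ TCD); apply: gKx; exists n, C, D; split=> //.
by rewrite KE -AE; exact: bigcap_inf.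
Qed.

Lemma BC2'_basics g C : BC2' f g -> basics T C -> g C = fc C.
Proof.
move=> g2 TC; have [BdC cC] := basics_neg TC; have [BdA cA] := basics_neg (f2.1 _ TC).
by apply: (BC2'_eq_of_complements f1 g2 cA cC) => //; [exact: BC2_preimage | exact: f3].
Qed.

Lemma BC2'_neg_basics g C : BC2' f g -> basics T C ->
  g (neg (Bd T) C) = neg (Bd S) (fc C).
Proof.
move=> g2 TC; have [BdC cC] := basics_neg TC; have [BdA cA] := basics_neg (f2.1 _ TC).
have [BdnC _ _] := cC; have [BdnA _ _] := cA.
apply: (BC2'_eq_of_complements f1 g2 (is_complementC cA BdA) (is_complementC cC BdC)) => //.
  exact: f3.
exact: BC2_preimage.
Qed.

End FromBasics.

(** * From the adjoint back to basic continuity *)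

Lemma preimage_basic_continuous g :
  BC1 f -> BC2' f g -> BC3' g -> BC4' g -> basic_continuous f.
Proof.
move=> f1 g2 g3 g4; split=> //; exists g; split.
- split=> [|B C SB TC]; first exact: g3.
  by apply: g2.2; exact: basics_sub_Bd.
- move=> C TC; rewrite -g4 //; apply: BC2'_preimage => //.
  by have [_ []] := basics_neg TC.
move=> n C D TCD; set K := clause (Bd T) C D.
have BdK : Bd T K by exact: Bd_clause.
(* [g] is monotone as an adjoint, so [g K] contains the value of [g] at each literal. *)
have gmono A : Bd T A -> A `<=` K -> g A `<=` g K.
  move=> BdA AK; apply: BC2'_max => //; first exact: g2.1.
  by apply: subset_trans (BC2'_preimage g2 BdA) _ => x; exact: AK.
apply: subset_trans (BC2'_preimage g2 BdK).
apply: bigjoin_sub => [|k]; first exact: g2.1.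
have [TC TD] := TCD k.
have lit : join (Bd T) (C k) (neg (Bd T) (D k)) `<=` K.
  exact: (@bigjoin_ub _ _ _ (fun k => join (Bd T) (C k) (neg (Bd T) (D k)))).
apply: join_sub; first exact: g2.1.
  apply: gmono; first exact: basics_sub_Bd.
  by apply: subset_trans lit; exact: join_ubl.
rewrite -g4 //; apply: gmono; first by have [_ []] := basics_neg TD.
by apply: subset_trans lit; exact: join_ubr.
Qed.

End BasicContinuity.

Theorem theorem5p1 (S T : b0space) (f : S -> T) :
  (basic_continuous f <->
     BC1 f /\ exists g : set T -> set S, [/\ BC2' f g, BC3' g & BC4' g]) /\
  (basic_continuous f ->
     forall g : set T -> set S, BC2' f g ->
       is_basic_preimage f g /\
       forall h : set T -> set S, is_basic_preimage f h ->
         forall K : set T, Bd T K -> h K = g K).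
Proof.
split; last first.
  move=> _ g g2; split; first exact/is_basic_preimageE.
  by move=> h /is_basic_preimageE h2 K; exact: BC2'_unique h2 g2.
split=> [[f1 [fc [f2 f3 f4]]]|[f1 [g [g2 g3 g4]]]]; last first.
  exact: preimage_basic_continuous g2 g3 g4.
have g2 := preimage_of_basics_adjoint f1 f2 f3 f4.
split=> //; exists (preimage_of_basics fc).
have gE C : basics T C -> preimage_of_basics fc C = fc C.
  exact: (BC2'_basics f1 f2 f3).
split=> // C TC; rewrite (gE C TC); first exact: f2.1.
exact: (BC2'_neg_basics f1 f2 f3).
Qed.
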